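(* The actions of DOSS must noisily activate at least one basic index set: for every $t$ there exists a basic index set $I_t$ such that $x_t\in\widetilde{\mathcal{X}}_t^{I_t}$.
   Context: Safe linear bandit (SLB) setting. Integers $d,U\ge 1$, $K\ge 0$, $m=U+K$; a known polytope $\mathcal{X}=\{x\in\mathbb{R}^d: Bx\le\beta\}$ ($B$ has $K$ rows) contained in $\{\|x\|\le 1\}$; an unknown $\theta\in\mathbb{R}^d$; a matrix $A\in\mathbb{R}^{m\times d}$ with rows $a^1,\dots,a^m$ whose first $U$ rows are unknown and whose last $K$ rows are those of $B$; a known $\alpha\in\mathbb{R}^m$ whose last $K$ entries are $\beta$. Assume $\|\theta\|\le 1$, $\|a^i\|\le 1$ for all $i$, and $\mathcal{S}=\{x:Ax\le\alpha\}\ne\emptyset$. For $I\subset\{1,\dots,m\}$, $M(I)$ denotes the restriction of a matrix or vector $M$ to rows in $I$. In round $t$ the learner picks $x_t\in\mathcal{X}$ based on the past history $\mathscr{H}_{t-1}$ and observes $r_t=\langle\theta,x_t\rangle+w_t^R$, $s_t^i=\langle a^i,x_t\rangle+w_t^{S,i}$ ($1\le i\le U$), where the noise $w_t$ is conditionally centred and $1$-subGaussian given $\sigma(\mathscr{H}_{t-1},x_t)$. DOSS($\delta$), $\delta\in(0,1)$. Let $V_t=I+\sum_{s\le t}x_sx_s^\top$, $\|z\|_V=\sqrt{z^\top Vz}$, $\hat\theta_t=V_{t-1}^{-1}\sum_{s<t}r_sx_s$, $\hat a_t^i=V_{t-1}^{-1}\sum_{s<t}s_s^ix_s$ for $i\le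 U$, $\hat a_t^i=a^i$ for $i>U$, and $\sqrt{\omega_t(\delta)}=1+\sqrt{\tfrac12\log\frac{(U+1)\sqrt{\det V_{t-1}}}{\delta}}$. Let $\mathcal{C}_t^\theta=\{\tilde\theta:\|\tilde\theta-\hat\theta_t\|_{V_{t-1}}\le\sqrt{\omega_t(\delta)}\}$ and let $\boldsymbol{\mathcal{C}}_t$ be the set of $\tilde A\in\mathbb{R}^{m\times d}$ with rows $\|\tilde a^i-\hat a_t^i\|_{V_{t-1}}\le\sqrt{\omega_t(\delta)}$ for $i\le U$ and $\tilde a^i=a^i$ for $i>U$. Let $\widetilde{\mathcal{S}}_t=\{x:\exists\tilde A\in\boldsymbol{\mathcal{C}}_t,\ \tilde Ax\le\alpha\}$. DOSS plays $x_t$ where $(\tilde\theta_t,x_t)\in\arg\max\{\langle\tilde\theta,x\rangle:\tilde\theta\in\mathcal{C}_t^\theta,\ x\in\widetilde{\mathcal{S}}_t\}$. A basic index set (BIS) is a set $I\subset\{1,\dots,m\}$ with $|I|=d$. The set of points that noisily activate $I$ at time $t$ is $\widetilde{\mathcal{X}}_t^I=\{x\in\widetilde{\mathcal{S}}_t:\exists\tilde A\in\boldsymbol{\mathcal{C}}_t,\ \tilde A(I)x=\alpha(I)\}$.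
   Formalization: A tie-breaking rule is added: when the optimal optimistic value is exactly 0, x_t must not be the midpoint of two distinct optimal actions. With arbitrary choice in the arg max the claim can fail, e.g. d=1, X=[1/4,1], all of X optimal with value 0 and x_t=1/2. *)

(* Defs.v *)
From HB Require Import structures.
From mathcomp Require Import all_boot all_order all_algebra.
From mathcomp Require Import all_classical all_reals all_analysis.

Set Implicit Arguments.
Unset Strict Implicit.
Unset Printing Implicit Defensive.

Import Order.TTheory GRing.Theory Num.Theory.
Import numFieldNormedType.Exports.

Local Open Scope classical_set_scope.
Local Open Scope ring_scope.

(* The library norm on matrices is the sup norm, hence these definitions. *)
Definition dot (R : realType) (n : nat) (u v : 'cV[R]_n) : R :=
  \sum_(i < n) u i 0 * v i 0.

Definition enorm (R : realType) (n : nat) (u : 'cV[R]_n) : R :=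
  Num.sqrt (dot u u).

Definition vnorm (R : realType) (n : nat) (V : 'M[R]_n) (z : 'cV[R]_n) : R :=
  Num.sqrt (dot z (V *m z)).

Definition lecv (R : realType) (n : nat) (u v : 'cV[R]_n) : Prop :=
  forall i, u i 0 <= v i 0.

(* The restriction M(I) of M to the rows in I, in increasing order. *)
Definition restrict_rows (R : realType) (m n : nat) (I : {set 'I_m})
    (M : 'M[R]_(m, n)) : 'M[R]_(#|I|, n) :=
  rowsub (fun k : 'I_#|I| => enum_val k) M.

(* B, beta : known polytope; Aunk : the U unknown rows; alphaunk : their known
   levels.  The K known rows come last, so i <= U is [lshift K i] and i > U is
   [rshift U i]. *)
Record slb (R : realType) (d U K : nat) := SLB {
  slb_B : 'M[R]_(K, d);
  slb_beta : 'cV[R]_K;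
  slb_theta : 'cV[R]_d;
  slb_Aunk : 'M[R]_(U, d);
  slb_alphaunk : 'cV[R]_U }.

Section Instance.
Variables (R : realType) (d U K : nat) (p : slb R d U K).

Definition slb_A : 'M[R]_(U + K, d) := col_mx (slb_Aunk p) (slb_B p).

Definition slb_alpha : 'cV[R]_(U + K) := col_mx (slb_alphaunk p) (slb_beta p).

Definition action_set : set 'cV[R]_d :=
  [set x | lecv (slb_B p *m x) (slb_beta p)].

Definition safe_set : set 'cV[R]_d := [set x | lecv (slb_A *m x) slb_alpha].

Definition slb_assumptions : Prop :=
  [/\ action_set `<=` [set x | enorm x <= 1],
      enorm (slb_theta p) <= 1,
      (forall i : 'I_(U + K), enorm (row i slb_A)^T <= 1)
    & safe_set !=set0].

End Instance.

(* Rounds are numbered from 0, so "before round t" means s < t. *)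
Section Interaction.
Context (R : realType) (d U K : nat) (p : slb R d U K).
Context (disp : measure_display) (T : measurableType disp) (P : probability T R).
(* [w t o] stacks the reward noise on top of the U safety noises. *)
Variables (x : nat -> T -> 'cV[R]_d) (w : nat -> T -> 'cV[R]_(1 + U)).

Definition reward (t : nat) (o : T) : R :=
  dot (slb_theta p) (x t o) + usubmx (w t o) 0 0.

Definition safety (t : nat) (o : T) : 'cV[R]_U :=
  slb_Aunk p *m x t o + dsubmx (w t o).

Definition preimage_events (f : T -> R) : set (set T) :=
  [set E | exists2 C : set R, measurable C & E = f @^-1` C].

(* sigma(H_{t-1}, x_t) *)
Definition past_events (t : nat) : set (set T) :=
  <<s [set E |
        [\/ exists s (i : 'I_d), (s <= t)%N /\
              preimage_events (fun o => x s o i 0) E,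
            exists s, (s < t)%N /\ preimage_events (reward s) E
          | exists s (i : 'I_U), (s < t)%N /\
              preimage_events (fun o => safety s o i 0) E ] ] >>.

(* E[w_t | sigma(H_{t-1}, x_t)] = 0, tested on the events of the
   sigma-algebra. *)
Definition cond_centred (t : nat) : Prop :=
  forall i : 'I_(1 + U),
    P.-integrable setT (fun o => (w t o i 0)%:E) /\
    forall E, past_events t E -> (\int[P]_(o in E) (w t o i 0)%:E = 0)%E.

(* E[exp <l, w_t> | sigma(H_{t-1}, x_t)] <= exp (|l|^2 / 2) for all l, tested
   on the events of the sigma-algebra. *)
Definition cond_subgaussian (t : nat) : Prop :=
  forall (l : 'cV[R]_(1 + U)) E, past_events t E ->
    (\int[P]_(o in E) (expR (dot l (w t o)))%:E
       <= (expR (enorm l ^+ 2 / 2))%:E * P E)%E.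

Definition slb_interaction : Prop :=
  [/\ (forall t (i : 'I_d), measurable_fun setT (fun o => x t o i 0)),
      (forall t (i : 'I_(1 + U)), measurable_fun setT (fun o => w t o i 0)),
      (forall t o, action_set p (x t o)),
      (forall t, cond_centred t)
    & (forall t, cond_subgaussian t)].

End Interaction.

(* DOSS along one realization: xs, rs, ss are the observed actions, rewards and
   safety signals; only their values at s < t are used in round t, and neither
   [slb_theta] nor [slb_Aunk] is used. *)
Section Doss.
Context (R : realType) (d U K : nat) (p : slb R d U K).
Variables (delta : R).
Variables (xs : nat -> 'cV[R]_d) (rs : nat -> R) (ss : nat -> 'cV[R]_U).
Variable t : nat.

(* V_{t-1} *)
Definition Vprev : 'M[R]_d := 1%:M + \sum_(s < t) xs s *m (xs s)^T.

Definition theta_hat : 'cV[R]_d := invmx Vprev *m \sum_(s < t) rs s *: xs s.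

Definition a_hat (i : 'I_U) : 'cV[R]_d :=
  invmx Vprev *m \sum_(s < t) ss s i 0 *: xs s.

Definition sqrt_omega : R :=
  1 + Num.sqrt (2^-1 * ln ((U.+1)%:R * Num.sqrt (\det Vprev) / delta)).

Definition conf_theta : set 'cV[R]_d :=
  [set th | vnorm Vprev (th - theta_hat) <= sqrt_omega].

Definition conf_A : set 'M[R]_(U + K, d) :=
  [set At |
    (forall i : 'I_U,
       vnorm Vprev ((row (lshift K i) At)^T - a_hat i) <= sqrt_omega) /\
    (forall i : 'I_K, row (rshift U i) At = row i (slb_B p))].

Definition permissible_set : set 'cV[R]_d :=
  [set x | exists2 At, conf_A At & lecv (At *m x) (slb_alpha p)].

(* (th, x) is in the arg max defining the play of DOSS. *)
Definition doss_argmax (th x : 'cV[R]_d) : Prop :=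
  [/\ conf_theta th, permissible_set x
    & forall th' x', conf_theta th' -> permissible_set x' ->
        dot th' x' <= dot th x].

Definition doss_actions : set 'cV[R]_d :=
  [set x | exists th, doss_argmax th x].

(* A tie-breaking rule that only applies when the optimal value is 0: x is then
   not the midpoint of two distinct optimal actions.  The objective
   max_th <th, x> = <theta_hat, x> + sqrt_omega |x|_{V^-1} is convex and is
   affine only along rays from the origin, so a non-extreme point can be optimal
   only on a segment of a ray where the objective vanishes.  An arbitrary
   choice on such a segment need not be a vertex: take d = U = 1,
   action_set = [1/4, 1], a large alphaunk, and rewards such that
   theta_hat = - sqrt_omega / sqrt V; every point of [1/4, 1] is optimal (with
   th = 0), but only 1/4 and 1 activate a constraint. *)
Definition breaks_zero_ties (th x : 'cV[R]_d) : Prop :=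
  dot th x = 0 ->
  forall y z, doss_actions y -> doss_actions z -> x = 2^-1 *: (y + z) -> y = z.

Definition is_BIS (I : {set 'I_(U + K)}) : Prop := #|I| = d.

Definition noisily_active (I : {set 'I_(U + K)}) : set 'cV[R]_d :=
  [set x | permissible_set x /\
     exists2 At, conf_A At &
       restrict_rows I At *m x = restrict_rows I (slb_alpha p)].

End Doss.

(* Main.v *)
(** Let J be the set of constraints that some member of the confidence set
    activates at x_t.  The confidence set is a product over rows, so a single
    matrix At activates all of J, and it can be taken to keep x_t strictly
    feasible for the constraints outside J.  If J had fewer than d elements,
    some v <> 0 would be orthogonal to the rows of At in J, and x_t + e v,
    x_t - e v would both be permissible for small e > 0.  By optimality both
    are optimal, with the same parameter as x_t.  The parameter maximizing
    <., y> over the confidence ellipsoid is unique and determines the ray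
    spanned by y <> 0, so v is a multiple of x_t, and orthogonality to the
    parameter forces the optimal value to be 0, where the tie-breaking rule
    applies. *)
Require Import Defs.
From HB Require Import structures.
From mathcomp Require Import all_boot all_order all_algebra.
From mathcomp Require Import all_classical all_reals all_analysis.
From mathcomp Require Import ring lra.

Import Order.TTheory GRing.Theory Num.Theory.
Import numFieldNormedType.Exports.

Set Implicit Arguments.
Unset Strict Implicit.
Unset Printing Implicit Defensive.

Local Open Scope classical_set_scope.
Local Open Scope ring_scope.

(** * The Euclidean inner product *)

Lemma dotE (R : realType) (n : nat) (u v : 'cV[R]_n) :
  dot u v = (u^T *m v) 0 0.
Proof. by rewrite mxE; apply: eq_bigr => i _; rewrite mxE. Qed.

Lemma dotC (R : realType) (n : nat) (u v : 'cV[R]_n) : dot u v = dot v u.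
Proof. by apply: eq_bigr => i _; rewrite mulrC. Qed.

Lemma dotDr (R : realType) (n : nat) (u v w : 'cV[R]_n) :
  dot u (v + w) = dot u v + dot u w.
Proof. by rewrite !dotE mulmxDr mxE. Qed.

Lemma dotZr (R : realType) (n : nat) (a : R) (u v : 'cV[R]_n) :
  dot u (a *: v) = a * dot u v.
Proof. by rewrite !dotE -scalemxAr mxE. Qed.

Lemma dotDl (R : realType) (n : nat) (u v w : 'cV[R]_n) :
  dot (u + v) w = dot u w + dot v w.
Proof. by rewrite dotC dotDr !(dotC w). Qed.

Lemma dotZl (R : realType) (n : nat) (a : R) (u v : 'cV[R]_n) :
  dot (a *: u) v = a * dot u v.
Proof. by rewrite dotC dotZr dotC. Qed.

Lemma dot_ge0 (R : realType) (n : nat) (u : 'cV[R]_n) : 0 <= dot u u.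
Proof. by apply: sumr_ge0 => i _; rewrite -expr2 sqr_ge0. Qed.

Lemma dot_eq0 (R : realType) (n : nat) (u : 'cV[R]_n) : dot u u = 0 -> u = 0.
Proof.
move/eqP; rewrite psumr_eq0 => [/allP u0|i _]; last by rewrite -expr2 sqr_ge0.
apply/matrixP => i j; rewrite ord1 mxE; apply/eqP.
by have := u0 i (mem_index_enum _); rewrite -expr2 sqrf_eq0.
Qed.

(** * Maximizing a linear form over an ellipsoid *)

Section Ellipsoid.
Context (R : realType) (d : nat) (V : 'M[R]_d).
Hypothesis V_sym : V^T = V.
Hypothesis V_ge1 : forall z, dot z z <= dot z (V *m z).

Lemma dot_symmx (u v : 'cV[R]_d) : dot u (V *m v) = dot v (V *m u).
Proof. by rewrite dotC !dotE trmx_mul V_sym mulmxA. Qed.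

Lemma posdef_eq0 (z : 'cV[R]_d) : dot z (V *m z) <= 0 -> z = 0.
Proof.
move=> z0; apply: dot_eq0; apply/eqP.
by rewrite eq_le dot_ge0 (le_trans (V_ge1 z) z0).
Qed.

Lemma posdef_unitmx : V \in unitmx.
Proof.
rewrite -row_free_unit -kermx_eq0; apply/negPn/negP => /rowV0Pn[u].
rewrite sub_kermx => /eqP uV; apply/negP; rewrite negbK.
have : u^T = 0.
  apply: posdef_eq0; rewrite dotE trmxK mulmxA uV mul0mx mxE.
  exact: lexx.
by move/(congr1 trmx); rewrite trmxK trmx0 => ->.
Qed.

Lemma vnorm_le_sqr (z : 'cV[R]_d) (r : R) : 0 <= r ->
  (vnorm V z <= r) = (dot z (V *m z) <= r ^+ 2).
Proof.
move=> r0; have z0 : 0 <= dot z (V *m z) := le_trans (dot_ge0 z) (V_ge1 z).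
by rewrite -[in LHS](ger0_norm r0) -sqrtr_sqr ler_sqrt // sqr_ge0.
Qed.

Lemma quadform_subZ (z q : 'cV[R]_d) (k : R) :
  dot (z - k *: q) (V *m (z - k *: q)) =
    dot z (V *m z) - 2 * (k * dot z (V *m q)) + k ^+ 2 * dot q (V *m q).
Proof.
rewrite -scaleNr mulmxDr -scalemxAr !dotDl !dotDr !dotZl !dotZr.
by rewrite (dot_symmx q z); ring.
Qed.

(* Equality case of Cauchy-Schwarz for the inner product of V. *)
Lemma ellipsoid_maximizer (c th y : 'cV[R]_d) (r : R) : 0 < r -> y != 0 ->
    vnorm V (th - c) <= r ->
    (forall th', vnorm V (th' - c) <= r -> dot th' y <= dot th y) ->
  exists2 k, 0 < k & V *m (th - c) = k *: y.
Proof.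
move=> r0 y0 th_in th_max.
(* The expected maximizer is [c + (r / N) *: q], where [N] is the norm of [y] for the inverse of
   [V]; its value exceeds that of [c] by [r * N]. *)
set q := invmx V *m y; have Vq : V *m q = y by rewrite mulKVmx ?posdef_unitmx.
set N := Num.sqrt (dot q y).
have qy0 : 0 < dot q y.
  rewrite -Vq lt_neqAle (le_trans (dot_ge0 q) (V_ge1 q)) andbT eq_sym.
  apply: contra_neq y0 => qq0; rewrite -Vq (@posdef_eq0 q) ?mulmx0 //.
  by rewrite qq0.
have N0 : 0 < N by rewrite sqrtr_gt0.
have NN : N ^+ 2 = dot q y by rewrite sqr_sqrtr // ltW.
have kq : (r / N) ^+ 2 * dot q y = r ^+ 2.
  by rewrite -NN; field; rewrite gt_eqF.
exists (r / N); first by rewrite divr_gt0.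
have {}th_max : r * N <= dot (th - c) y.
  have := th_max (c + (r / N) *: q).
  rewrite (addrC c) addrK (vnorm_le_sqr _ (ltW r0)) -scalemxAr Vq.
  rewrite dotZl dotZr mulrA -expr2 kq => /(_ (lexx _)).
  rewrite -scaleN1r !dotDl !dotZl -NN.
  have -> : r / N * N ^+ 2 = r * N by field; rewrite gt_eqF.
  lra.
move: th_in; rewrite (vnorm_le_sqr _ (ltW r0)); set z := th - c => z_in.
(* Expanding the quadratic form at [z - k *: q] bounds it by [r^2 - 2 r^2 + r^2 = 0]. *)
suff : z - (r / N) *: q = 0.
  by move/eqP; rewrite subr_eq0 => /eqP ->; rewrite -scalemxAr Vq.
apply: posdef_eq0; set k := r / N in kq *.
have -> : dot (z - k *: q) (V *m (z - k *: q)) =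
    dot z (V *m z) - 2 * (k * dot z y) + k ^+ 2 * dot q y.
  by rewrite quadform_subZ Vq.
have : r ^+ 2 <= k * dot z y.
  have -> : r ^+ 2 = k * (r * N) by rewrite /k; field; rewrite gt_eqF.
  by rewrite ler_pM2l // divr_gt0.
by rewrite kq; lra.
Qed.

End Ellipsoid.

(** * Kernel vectors, step sizes and subsets *)

Lemma kernel_vector (F : fieldType) (k n : nat) (M : 'M[F]_(k, n)) :
  (k < n)%N -> exists2 v : 'cV[F]_n, v != 0 & M *m v = 0.
Proof.
move=> kn; have : kermx M^T != 0.
  rewrite kermx_eq0 /row_free mxrank_tr neq_ltn.
  by rewrite (leq_ltn_trans (rank_leq_row M)).
case/rowV0Pn => u; rewrite sub_kermx => /eqP uM u0.
exists u^T; first by rewrite -trmx0 (inj_eq trmx_inj).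
by apply: trmx_inj; rewrite trmx_mul trmxK uM trmx0.
Qed.

(** Here [g] stands for the slacks of the constraints and [b] for their rates of change along a
    direction: one step size respects them all. *)
Lemma small_step (R : realFieldType) (J : finType) (b g : J -> R) :
    (forall j, 0 <= g j) -> (forall j, g j = 0 -> b j = 0) ->
  exists2 e, 0 < e & forall j, e * `|b j| <= g j.
Proof.
(* The sum dominates every ratio; an index with [g j = 0] adds 0 to it, as division by 0 gives 0. *)
move=> g0 gb; pose S := \sum_j `|b j| / g j.
have S0 : 0 <= S by apply: sumr_ge0 => j _; rewrite divr_ge0.
have S1 : 0 < 1 + S by lra.
exists (1 + S)^-1 => [|j]; first by rewrite invr_gt0.
rewrite mulrC ler_pdivrMr //; have [/eqP gj|gj] := boolP (g j == 0).
  by rewrite gb // normr0 gj mul0r.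
have : `|b j| / g j <= 1 + S.
  rewrite /S (bigD1 j) //= addrCA lerDl addr_ge0 //.
  by apply: sumr_ge0 => i _; rewrite divr_ge0.
by rewrite ler_pdivrMr 1?mulrC // lt_neqAle eq_sym gj g0.
Qed.

Lemma subset_of_card (T : finType) (J : {set T}) (k : nat) :
  (k <= #|J|)%N -> exists2 I : {set T}, I \subset J & #|I| = k.
Proof.
move=> kJ; exists [set i in take k (enum J)].
  by apply/fintype.subsetP => i; rewrite inE => /mem_take; rewrite mem_enum.
rewrite cardsE (card_uniqP _) ?take_uniq ?enum_uniq // size_takel //.
by rewrite -cardE.
Qed.

(** * One round of DOSS *)

Section Round.
Context (R : realType) (d U K : nat) (p : slb R d U K) (delta : R).
Context (xs : nat -> 'cV[R]_d) (rs : nat -> R) (ss : nat -> 'cV[R]_U) (t : nat).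

Let V := Vprev xs t.

Lemma Vprev_sym : V^T = V.
Proof.
rewrite /V /Vprev linearD /= tr_scalar_mx linear_sum /=; congr (_ + _).
by apply: eq_bigr => s _; rewrite trmx_mul trmxK.
Qed.

Lemma Vprev_ge1 (z : 'cV[R]_d) : dot z z <= dot z (V *m z).
Proof.
rewrite /V /Vprev mulmxDl mul1mx dotDr lerDl dotE mulmx_suml mulmx_sumr.
rewrite summxE; apply: sumr_ge0 => s _.
(* Each past action contributes the square of its inner product with [z]. *)
rewrite -mulmxA mulmxA mxE big_ord1 -!dotE dotC.
by rewrite -expr2 sqr_ge0.
Qed.

(** The leading 1 suffices whatever the sign of the logarithm: [Num.sqrt] is 0 on negative
    numbers. *)
Lemma sqrt_omega_gt0 : 0 < sqrt_omega U delta xs t.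
Proof. by rewrite ltr_pwDl // sqrtr_ge0. Qed.

Lemma conf_A_mix (F : 'I_(U + K) -> 'M[R]_(U + K, d)) :
    (forall i, conf_A p delta xs ss t (F i)) ->
  conf_A p delta xs ss t (\matrix_i row i (F i)).
Proof.
move=> FA; split=> i; rewrite rowK.
  by case: (FA (lshift K i)).
by case: (FA (rshift U i)).
Qed.

Let optimal := doss_argmax p delta xs rs ss t.

(** A linear form that is maximal at the midpoint of a segment is constant on it. *)
Lemma optimal_same_parameter (th x v : 'cV[R]_d) :
    optimal th x -> permissible_set p delta xs ss t (x + v) ->
    permissible_set p delta xs ss t (x - v) ->
  [/\ dot th v = 0, optimal th (x + v) & optimal th (x - v)].
Proof.
move=> [th_in x_in th_max] xDv xBv.
have thv : dot th v = 0.
  have := th_max _ _ th_in xDv; have := th_max _ _ th_in xBv.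
  by rewrite -scaleN1r !dotDr dotZr; lra.
split=> //; split=> // th' x' th'_in x'_in; rewrite dotDr.
  by rewrite thv addr0; apply: th_max.
by rewrite -scaleN1r dotZr thv mulr0 addr0; apply: th_max.
Qed.

(** With the action frozen at [y], [th] still maximizes over the ellipsoid. Hence [th] alone
    determines the ray of [y]. *)
Lemma optimal_ray (th y : 'cV[R]_d) : optimal th y -> y != 0 ->
  exists2 k, 0 < k & V *m (th - theta_hat xs rs t) = k *: y.
Proof.
move=> [th_in y_in th_max] y0.
apply: ellipsoid_maximizer sqrt_omega_gt0 y0 th_in _.
- exact: Vprev_sym.
- exact: Vprev_ge1.
- by move=> th' th'_in; apply: th_max.
Qed.

Lemma optimal_segment (th x v : 'cV[R]_d) :
    breaks_zero_ties p delta xs rs ss t th x ->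
    optimal th x -> permissible_set p delta xs ss t (x + v) ->
    permissible_set p delta xs ss t (x - v) ->
  v = 0.
Proof.
move=> tie opt xDv xBv.
have [thv optD optB] := optimal_same_parameter opt xDv xBv.
(* At value 0, [x] is the midpoint of the optimal actions [x + v] and [x - v], which the
   tie-breaking rule identifies. *)
have [thx|thx] := eqVneq (dot th x) 0.
  have : x + v = x - v.
    apply: tie => //; [by exists th|by exists th|].
    rewrite addrACA subrr addr0 scalerDr -scalerDl.
    have -> : 2^-1 + 2^-1 = 1 :> R by lra.
    by rewrite scale1r.
  move=> /addrI vN; have /eqP : 2%:R *: v = 0.
    by rewrite scaler_nat mulr2n {2}vN subrr.
  by rewrite scaler_eq0 pnatr_eq0 => /eqP.
have nz y : dot th y != 0 -> y != 0.
  by apply: contra_neq => ->; rewrite dotE mulmx0 mxE.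
have xDv0 : x + v != 0 by apply: nz; rewrite dotDr thv addr0.
have [k k0 kx] := optimal_ray opt (nz _ thx).
have [l l0] := optimal_ray optD xDv0; rewrite {}kx => kl.
(* Both [x] and [x + v] lie on the ray determined by [th]; pairing with [th], which gives both the
   same nonzero value, equates the scalars. *)
have kl' : k = l.
  have /eqP := congr1 (dot th) kl.
  rewrite !dotZr dotDr thv addr0 -subr_eq0 -mulrBl mulf_eq0 (negPf thx) orbF.
  by rewrite subr_eq0 => /eqP.
move/eqP: kl; rewrite kl' scalerDr -subr_eq0 opprD addNKr oppr_eq0.
by rewrite scaler_eq0 gt_eqF //= => /eqP.
Qed.

Lemma optimal_noisily_active (th x : 'cV[R]_d) :
    breaks_zero_ties p delta xs rs ss t th x -> optimal th x ->
  exists I : {set 'I_(U + K)},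
    is_BIS d I /\ noisily_active p delta xs ss t I x.
Proof.
move=> tie opt; have [_ [A0 A0_in A0_x] _] := opt.
pose active i A := conf_A p delta xs ss t A /\ (A *m x) i 0 = slb_alpha p i 0.
pose J := [set i | `[< exists A, active i A >]]%SET.
have [F FA] : {F : 'I_(U + K) -> 'M[R]_(U + K, d) & forall i,
    if i \in J then active i (F i) else F i = A0}.
  apply: (@choice _ _ (fun i A =>
    if i \in J then active i A else A = A0)) => i.
  rewrite inE; case: asboolP => [//|_].
  by exists A0.
pose A := \matrix_i row i (F i).
have A_row y i : (A *m y) i 0 = (F i *m y) i 0.
  by rewrite !mxE; apply: eq_bigr => j _; rewrite !mxE.
have A_in : conf_A p delta xs ss t A.
  by apply: conf_A_mix => i; have := FA i; case: ifP => [_ []|_ ->].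
have A_J i : i \in J -> (A *m x) i 0 = slb_alpha p i 0.
  by move=> iJ; have := FA i; rewrite iJ A_row => -[].
have A_le : lecv (A *m x) (slb_alpha p).
  move=> i; have [/A_J ->//|iJ] := boolP (i \in J).
  by rewrite A_row; have := FA i; rewrite (negPf iJ) => ->.
(* Since [A] is itself in the confidence set, a constraint tight for [A] is in [J]; so the slack is
   positive outside [J]. *)
have J_max i : (A *m x) i 0 = slb_alpha p i 0 -> i \in J.
  by move=> Ai; rewrite inE; apply/asboolP; exists A.
have [dJ|Jd] := leqP d #|J|.
  have [I IJ Id] := subset_of_card dJ; exists I; split=> //; split.
    by exists A.
  exists A => //; rewrite /restrict_rows mul_rowsub_mx.
  apply/matrixP => k j; rewrite ord1 mxE [RHS]mxE.
  exact: A_J (fintype.subsetP IJ _ (enum_valP k)).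
have [v v0 Jv] := kernel_vector (restrict_rows J A) Jd.
have A_v i : i \in J -> (A *m v) i 0 = 0.
  move=> iJ; have /matrixP/(_ (enum_rank_in iJ i) 0) := Jv.
  by rewrite /restrict_rows mul_rowsub_mx !mxE enum_rankK_in.
(* Zero slack occurs only in [J], where [v] leaves the constraint value unchanged. *)
have [||e e0 ev] := @small_step R _ (fun i => (A *m v) i 0)
    (fun i => slb_alpha p i 0 - (A *m x) i 0).
- by move=> i; rewrite subr_ge0.
- by move=> i /eqP; rewrite subr_eq0 => /eqP/esym/J_max/A_v.
(* The same [A] witnesses both signs, [c = e] and [c = - e]. *)
have feasible c : `|c| = e -> permissible_set p delta xs ss t (x + c *: v).
  move=> ce; exists A => // i; rewrite mulmxDr -scalemxAr mxE.
  rewrite -lerBrDl mxE (le_trans _ (ev i)) // -ce -normrM; exact: ler_norm.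
have /eqP : e *: v = 0.
  apply: (optimal_segment tie opt); first by apply: feasible; rewrite gtr0_norm.
  by rewrite -scaleNr; apply: feasible; rewrite normrN gtr0_norm.
by rewrite scaler_eq0 (negPf v0) gt_eqF.
Qed.

End Round.

Theorem proposition6p5 (R : realType) (d U K : nat)
    (hd : (0 < d)%N) (hU : (0 < U)%N)
    (p : slb R d U K) (hp : slb_assumptions p)
    (disp : measure_display) (T : measurableType disp) (P : probability T R)
    (x : nat -> T -> 'cV[R]_d) (w : nat -> T -> 'cV[R]_(1 + U))
    (hxw : slb_interaction p P x w)
    (delta : R) (hdelta : 0 < delta < 1)
    (thetat : nat -> T -> 'cV[R]_d) (t : nat) (o : T)
    (hDOSS : doss_argmax p delta
       (fun s => x s o) (fun s => reward p x w s o) (fun s => safety p x w s o)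
       t (thetat t o) (x t o))
    (htie : breaks_zero_ties p delta
       (fun s => x s o) (fun s => reward p x w s o) (fun s => safety p x w s o)
       t (thetat t o) (x t o)) :
  exists I : {set 'I_(U + K)},
    is_BIS d I /\
    noisily_active p delta (fun s => x s o) (fun s => safety p x w s o)
      t I (x t o).
Proof. exact: optimal_noisily_active htie hDOSS. Qed.
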